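(* Let $R$ be a tolerance on a set $U$. Then the ordered sets $\wp(U)^{\blacktriangle}$ and $\wp(U)^{\blacktriangledown}$ are ortholattices: the map ${}^\bot\colon X^{\blacktriangle}\mapsto ((X^{\blacktriangle})^c)^{\blacktriangle}$ is an orthocomplementation of $\wp(U)^{\blacktriangle}$, and the map ${}^\top\colon X^{\blacktriangledown}\mapsto ((X^{\blacktriangledown})^c)^{\blacktriangledown}$ is an orthocomplementation of $\wp(U)^{\blacktriangledown}$.
   Context: A tolerance on $U$ is a reflexive and symmetric binary relation $R$ on $U$; $R(x)=\{y\in U\mid x\,R\,y\}$. For $X\subseteq U$, $X^{\blacktriangledown}=\{x\in U\mid R(x)\subseteq X\}$, $X^{\blacktriangle}=\{x\in U\mid R(x)\cap X\neq\emptyset\}$, and $X^c=U\setminus X$. $\wp(U)^{\blacktriangledown}=\{X^{\blacktriangledown}\mid X\subseteq U\}$ and $\wp(U)^{\blacktriangle}=\{X^{\blacktriangle}\mid X\subseteq U\}$ are ordered by inclusion; they are complete lattices. An orthocomplementation on a bounded lattice is a map $x\mapsto x^\bot$ such that $x\le y$ implies $y^\bot\le x^\bot$; $x^{\bot\bot}=x$; $x\vee x^\bot=1$ and $x\wedge x^\bot=0$. An ortholattice is a bounded lattice equipped with an orthocomplementation. *)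

(* Defs.v *)
From HB Require Import structures.
From mathcomp Require Import all_boot all_order.
From mathcomp Require Import boolp classical_sets.
From Corelib Require Relation_Definitions.
Set Implicit Arguments. Unset Strict Implicit. Unset Printing Implicit Defensive.
Import Order.TTheory.
Local Open Scope classical_set_scope.
Local Open Scope order_scope.

Record orthocomplementation d (L : tbLatticeType d) (f : L -> L) : Prop := {
  ortho_anti : forall x y : L, x <= y -> f y <= f x;
  orthoK     : forall x : L, f (f x) = x;
  ortho_join : forall x : L, x `|` f x = \top;
  ortho_meet : forall x : L, x `&` f x = \bot }.

(* The ordered set [L] is an ortholattice with orthocomplementation [f].  Being a
   bounded lattice is part of the assertion: [c] is a bounded lattice structure
   on the carrier of [L] whose order is the order of [L]. *)
Definition ortholattice_by d (L : porderType d) (f : L -> L) : Prop :=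
  exists c : Order.TBLattice.axioms_ d L,
    let B : tbLatticeType d := Order.TBLattice.Pack c in
    (forall x y : L, ((x : B) <= (y : B)) = (x <= y)) /\
    @orthocomplementation d B f.

Section Approximations.
Variables (U : Type) (R : U -> U -> Prop).

Definition tolerance : Prop :=
  Relation_Definitions.reflexive U R /\ Relation_Definitions.symmetric U R.

Definition nbhd (x : U) : set U := [set y | R x y].

Definition lower (X : set U) : set U := [set x | nbhd x `<=` X].
Definition upper (X : set U) : set U := [set x | nbhd x `&` X !=set0].

Definition uppers := set_type (range upper).
Definition lowers := set_type (range lower).

(* The order induced by inclusion. *)
HB.instance Definition _ := SubChoice.copy uppers (set_type (range upper)).
HB.instance Definition _ :=
  [SubChoice_isSubPOrder of uppers by <: with set_display].
HB.instance Definition _ := SubChoice.copy lowers (set_type (range lower)).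
HB.instance Definition _ :=
  [SubChoice_isSubPOrder of lowers by <: with set_display].

Definition to_uppers (X : set U) : uppers :=
  exist _ (upper X) (mem_set (imageT upper X)).
Definition to_lowers (X : set U) : lowers :=
  exist _ (lower X) (mem_set (imageT lower X)).

(* The complement of an [A] in the family is in general not in the family. *)
Definition upper_ortho (A : uppers) : uppers := to_uppers (~` (val A)).
Definition lower_ortho (A : lowers) : lowers := to_lowers (~` (val A)).

End Approximations.

(* Main.v *)
Require Import Defs.
From HB Require Import structures.
From mathcomp Require Import all_boot all_order.
From mathcomp Require Import boolp classical_sets.
Import Order.TTheory.
Local Open Scope order_scope.

(** By symmetry, [upper] and [lower] form a Galois connection, so
    [upper (lower A) = A] for every upper approximation [A]. Complementation
    exchanges [upper] and [lower], hence [upper (~` upper (~` A))] is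
    [upper (lower A)]: the map on upper approximations is an antitone involution,
    and dually on lower approximations. The complement laws come from
    reflexivity, which gives [lower X `<=` X `<=` upper X]. An antitone involution
    turns binary joins into binary meets and vice versa, so it is enough that
    upper approximations are closed under union and lower ones under
    intersection. *)

Section OrthoFromInvolution.
Context {d : Order.disp_t} {L : porderType d} {f : L -> L}.
Hypotheses (fanti : forall x y, x <= y -> f y <= f x) (fK : involutive f).

Lemma le_involution x y : (x <= f y) = (y <= f x).
Proof. by apply/idP/idP => /fanti; rewrite fK. Qed.

Lemma involution_le x y : (f x <= y) = (f y <= x).
Proof. by apply/idP/idP => /fanti; rewrite fK. Qed.

(** De Morgan forces the remaining operations: the meet is [f (join (f x) (f y))] and the top is
    [f bot]. The last hypothesis expresses excluded middle through the order alone, before [L]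
    carries a lattice structure. *)
Lemma ortholattice_by_join (bot : L) (join : L -> L -> L) :
    (forall x, bot <= x) ->
    (forall x y z, (join x y <= z) = (x <= z) && (y <= z)) ->
    (forall x z, x <= z -> f x <= z -> f bot <= z) ->
  ortholattice_by f.
Proof.
move=> bot_le joinP fcompl.
pose meet x y := f (join (f x) (f y)).
have meetP x y z : (x <= meet y z) = (x <= y) && (x <= z).
  by rewrite le_involution joinP ![f _ <= f _]involution_le !fK.
have le_top x : x <= f bot by rewrite le_involution.
(* The [Build] constructors do not unify here: [porderType] has no eta rule, so
   the variable [L] is not convertible to a [Pack] term. *)
pose c := @Order.TBLattice.Class d L _ _ _
  (Order.hasTop.Axioms_ (Order.POrder.class L) _ le_top)
  (Order.hasBottom.Axioms_ (Order.POrder.class L) _ bot_le)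
  _ (Order.POrder_isMeetSemilattice.Axioms_ (Order.POrder.class L) _ meetP)
  (Order.POrder_isJoinSemilattice.Axioms_ (Order.POrder.class L) _ joinP).
pose B : tbLatticeType d := Order.TBLattice.Pack c.
have le_join_compl (x : B) : \top <= x `|` f x.
  exact: (fcompl x) (@leUl _ B x (f x)) (@leUr _ B (f x) x).
exists c; split=> //; split=> // x; apply/eqP.
- by rewrite -(@le1x _ B); exact: le_join_compl.
(* Non-contradiction at [x] is the image under [f] of excluded middle at [f x]. *)
- rewrite -(@lex0 _ B); change (f (join (f x) (f (f x))) <= bot).
  by rewrite involution_le; exact: le_join_compl.
Qed.

(** The involution replaces order duality: [f top] serves as bottom and [f (meet (f x) (f y))] as
    join. *)
Lemma ortholattice_by_meet (top : L) (meet : L -> L -> L) :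
    (forall x, x <= top) ->
    (forall x y z, (x <= meet y z) = (x <= y) && (x <= z)) ->
    (forall x z, z <= x -> z <= f x -> z <= f top) ->
  ortholattice_by f.
Proof.
move=> le_top meetP fcompl.
apply: (@ortholattice_by_join (f top) (fun x y => f (meet (f x) (f y)))).
- by move=> x; rewrite involution_le.
- by move=> x y z; rewrite involution_le meetP ![f z <= f _]involution_le !fK.
- move=> x z lexz lefxz; rewrite involution_le; apply: (fcompl x).
    by rewrite involution_le.
  exact: fanti.
Qed.

End OrthoFromInvolution.

Section ToleranceApproximations.
Local Open Scope classical_set_scope.
Context {U : Type} {R : U -> U -> Prop}.
Implicit Types (X Y : set U).

Local Notation upper := (upper R).
Local Notation lower := (lower R).

Lemma lowerC X : lower (~` X) = ~` upper X.
Proof.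
apply/seteqP; split=> x /=.
  by move=> RX [y [Rxy Xy]]; exact: RX Rxy Xy.
by move=> nRX y Rxy Xy; apply: nRX; exists y.
Qed.

Lemma upperC X : upper (~` X) = ~` lower X.
Proof. by rewrite -[in RHS](setCK X) lowerC setCK. Qed.

Lemma upperS X Y : X `<=` Y -> upper X `<=` upper Y.
Proof. by move=> XY x [y [Rxy Xy]]; exists y; split=> //; exact: XY. Qed.

Lemma lowerS X Y : X `<=` Y -> lower X `<=` lower Y.
Proof. by move=> XY x RX; exact: subset_trans RX XY. Qed.

Lemma upperU X Y : upper (X `|` Y) = upper X `|` upper Y.
Proof.
apply/seteqP; split=> x.
  by case=> y [Rxy [Xy|Yy]]; [left|right]; exists y.
by case; apply: upperS; [exact: subsetUl|exact: subsetUr].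
Qed.

Lemma lowerI X Y : lower (X `&` Y) = lower X `&` lower Y.
Proof. by apply: setC_inj; rewrite setCI -!upperC setCI upperU. Qed.

Lemma upper0 : upper set0 = set0.
Proof. by rewrite -subset0 => x [y []]. Qed.

Lemma lowerT : lower setT = setT.
Proof. by apply: setC_inj; rewrite -upperC setCT upper0. Qed.

Hypothesis hR : tolerance R.

Lemma sub_upper X : X `<=` upper X.
Proof. by move=> x Xx; exists x; split=> //; exact: hR.1. Qed.

Lemma lower_sub X : lower X `<=` X.
Proof. by move=> x; apply; exact: hR.1. Qed.

(** If [y] is a neighbour of [x] and [nbhd y] lies in [X], symmetry puts [x] in [nbhd y]. *)
Lemma upper_lower_sub X : upper (lower X) `<=` X.
Proof. by move=> x [y [Rxy]]; apply; exact: hR.2. Qed.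

Lemma sub_lower_upper X : X `<=` lower (upper X).
Proof. by move=> x Xx y Rxy; exists x; split=> //; exact: hR.2. Qed.

Lemma upperK (A : uppers R) : upper (lower (val A)) = val A.
Proof.
have [X _ <-] := set_mem (valP A).
apply/seteqP; split; first exact: upper_lower_sub.
exact: upperS (@sub_lower_upper X).
Qed.

Lemma lowerK (A : lowers R) : lower (upper (val A)) = val A.
Proof.
have [X _ <-] := set_mem (valP A).
apply/seteqP; split; last exact: sub_lower_upper.
exact: lowerS (@upper_lower_sub X).
Qed.

Lemma le_uppers (A B : uppers R) : A <= B <-> val A `<=` val B.
Proof. by rewrite -Order.le_val subsetEset. Qed.

Lemma le_lowers (A B : lowers R) : A <= B <-> val A `<=` val B.
Proof. by rewrite -Order.le_val subsetEset. Qed.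

Lemma upper_ortholattice : ortholattice_by (@upper_ortho U R).
Proof.
(* By [upperU] and [upperK] this join is the plain union; presenting it as an upper approximation
   makes it an element of [uppers]. *)
apply: (@ortholattice_by_join _ _ _ _ _ (to_uppers R set0)
  (fun A B => to_uppers R (lower (val A) `|` lower (val B)))).
- move=> A B /le_uppers AB; apply/le_uppers => /=.
  exact: upperS (subsetC AB).
- by move=> A; apply: val_inj; rewrite /= -lowerC setCK upperK.
- by move=> A; apply/le_uppers; rewrite /= upper0.
- move=> A B C; apply/idP/andP => [/le_uppers|[/le_uppers AC /le_uppers BC]].
    by rewrite /= upperU !upperK subUset => -[AC BC]; split; apply/le_uppers.
  by apply/le_uppers; rewrite /= upperU !upperK subUset.
(* A point outside [A] lies in the upper approximation of the complement, so [C] is all of [U]. *)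
- move=> A C /le_uppers AC /le_uppers nAC; apply/le_uppers => x _.
  have [/AC //|nAx] := pselect (val A x).
  by apply: nAC; apply: sub_upper.
Qed.

Lemma lower_ortholattice : ortholattice_by (@lower_ortho U R).
Proof.
(* By [lowerI] and [lowerK] this meet is the plain intersection. *)
apply: (@ortholattice_by_meet _ _ _ _ _ (to_lowers R setT)
  (fun A B => to_lowers R (upper (val A) `&` upper (val B)))).
- move=> A B /le_lowers AB; apply/le_lowers => /=.
  exact: lowerS (subsetC AB).
- by move=> A; apply: val_inj; rewrite /= -upperC setCK lowerK.
- by move=> A; apply/le_lowers; rewrite /= lowerT.
- move=> A B C; apply/idP/andP => [/le_lowers|[/le_lowers AB /le_lowers AC]].
    by rewrite /= lowerI !lowerK subsetI => -[AB AC]; split; apply/le_lowers.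
  by apply/le_lowers; rewrite /= lowerI !lowerK subsetI.
(* [lower_ortho A] lies inside the complement of [A], so [C] is empty. *)
- move=> A C /le_lowers CA /le_lowers CnA; apply/le_lowers => x Cx.
  have nAx : (~` val A) x := lower_sub _ _ (CnA x Cx).
  by case: nAx; exact: CA.
Qed.

End ToleranceApproximations.

Theorem mainTheorem1 (U : Type) (R : U -> U -> Prop) (hR : tolerance R) :
  ortholattice_by (@upper_ortho U R) /\ ortholattice_by (@lower_ortho U R).
Proof. by split; [exact: upper_ortholattice|exact: lower_ortholattice]. Qed.
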